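(* Let $E$ be a finite-dimensional real inner product space. Let $f:E\to\mathbb{R}$ be a differentiable convex function whose gradient is $L$-Lipschitz continuous with $L>0$, let $h:E\to\mathbb{R}$ be a continuous convex function, and put $\psi=f+h$. Suppose $\psi$ attains its minimum over $E$ at $x^*$, and let $\psi^*=\psi(x^* )$. Let $t\in(0,\frac1L]$, $x^0\in E$, and let $(x^k)_{k\ge0}$ be the sequence generated by the proximal gradient method with fixed step size $t$, $$x^{k+1}=\operatorname{prox}_{t h}\bigl(x^k-t\nabla f(x^k)\bigr),\qquad k\ge0 .$$ Then for every integer $k\ge1$, $$\psi(x^k)-\psi^*\le\frac{1}{2kt}\|x^0-x^*\|^2 .$$
   Context: For a function $g:E\to\mathbb{R}$, $u=\operatorname{prox}_g(x)$ means that $u$ minimizes $v\mapsto g(v)+\frac12\|v-x\|^2$ over $E$ (for continuous convex $g$ such a $u$ exists and is unique). *)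

(* Defs.v *)
From HB Require Import structures.
From mathcomp Require Import all_boot all_order all_algebra.
From mathcomp Require Import all_classical all_reals all_analysis.

Set Implicit Arguments.
Unset Strict Implicit.
Unset Printing Implicit Defensive.

Import Order.TTheory GRing.Theory Num.Theory.
Import numFieldNormedType.Exports.

Local Open Scope classical_set_scope.
Local Open Scope ring_scope.

#[short(type="finNormedModType")]
HB.structure Definition FinNormedModule (R : realType) :=
  {E of NormedModule R E & Vector R E}.

Definition norm_of_dot (R : realType) (E : normedModType R)
    (dot : {dot E for idfun}) : Prop :=
  forall x : E, `|x| = Num.sqrt (dot x x).

(* Equal to 0 when f has no gradient at x; where f is differentiable and E is
   finite dimensional, the vector representing 'd f x exists and is unique. *)
Definition gradient (R : realType) (E : normedModType R)
    (dot : {dot E for idfun}) (f : E -> R) (x : E) : E :=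
  xget 0 [set g : E | differentiable f x /\ forall v : E, 'd f x v = dot g v].

Definition is_prox (R : realType) (E : normedModType R) (g : E -> R)
    (x u : E) : Prop :=
  forall v : E,
    g u + 2^-1 * `|u - x| ^+ 2 <= g v + 2^-1 * `|v - x| ^+ 2.

(* Main.v *)
(* Convexity of f bounds f from below by its linearisation at x^k, and the
   Lipschitz gradient bounds it from above by the same linearisation plus
   (1/2t)|. - x^k|^2.  With the variational inequality for the prox this gives,
   for every v,
     2t (psi(x^{k+1}) - psi(v)) <= |x^k - v|^2 - |x^{k+1} - v|^2.
   Taking v = x^k shows that psi(x^k) decreases; taking v = x^* and summing
   telescopes. *)
Require Import Defs.
From HB Require Import structures.
From mathcomp Require Import all_boot all_order all_algebra.
From mathcomp Require Import all_classical all_reals all_analysis.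
From mathcomp Require Import lra.

Set Implicit Arguments.
Unset Strict Implicit.
Unset Printing Implicit Defensive.

Import Order.TTheory GRing.Theory Num.Theory.
Import numFieldNormedType.Exports.

Local Open Scope classical_set_scope.
Local Open Scope ring_scope.

(** * Inner product calculus and the Cauchy-Schwarz inequality *)

Section RealInnerProduct.
Variables (R : realType) (E : normedModType R) (dot : {dot E for idfun}).

Lemma dotC (u v : E) : dot u v = dot v u.
Proof. by rewrite hermC expr0 mul1r. Qed.

Lemma dotDl (u v w : E) : dot (u + v) w = dot u w + dot v w.
Proof. exact: linearDl. Qed.

Lemma dotZl (a : R) (u v : E) : dot (a *: u) v = a * dot u v.
Proof. exact: linearZl_LR. Qed.

Lemma dotDr (u v w : E) : dot w (u + v) = dot w u + dot w v.
Proof. exact: linearDr. Qed.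

Lemma dotZr (a : R) (u v : E) : dot v (a *: u) = a * dot v u.
Proof. by rewrite dotC dotZl dotC. Qed.

Lemma dotNl (u v : E) : dot (- u) v = - dot u v.
Proof. exact: linearNl. Qed.

Lemma dotNr (u v : E) : dot v (- u) = - dot v u.
Proof. exact: linearNr. Qed.

Lemma dot_suml (I : finType) (F : I -> E) (v : E) :
  dot (\sum_i F i) v = \sum_i dot (F i) v.
Proof. exact: linear_sumlz. Qed.

Lemma dot_sumr (I : finType) (F : I -> E) (v : E) :
  dot v (\sum_i F i) = \sum_i dot v (F i).
Proof. exact: linear_sumr. Qed.

Definition dotE := (dotDl, dotDr, dotNl, dotNr, dotZl, dotZr).

Lemma dot_ge0 (u : E) : 0 <= dot u u.
Proof.
have [->|u0] := eqVneq u 0; last exact/ltW/neq0_dnorm_gt0.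
by rewrite linear0l.
Qed.

Lemma dot_eq0 (u : E) : dot u u = 0 -> u = 0.
Proof.
move=> uu0; apply/eqP/negPn/negP => /(@neq0_dnorm_gt0 _ _ _ dot).
by rewrite uu0 ltxx.
Qed.

Hypothesis normE : norm_of_dot dot.

Lemma sqr_normE (u : E) : `|u| ^+ 2 = dot u u.
Proof. by rewrite normE sqr_sqrtr ?dot_ge0. Qed.

(** The squared norm of [|v| u - |u| v] is [2 |u| |v| (|u| |v| - dot u v)]; it is nonnegative, and
    for nonzero vectors the factor [|u| |v|] can be cancelled. *)
Lemma dot_le_norm (u v : E) : dot u v <= `|u| * `|v|.
Proof.
have [->|u0] := eqVneq u 0; first by rewrite linear0l normr0 mul0r.
have [->|v0] := eqVneq v 0; first by rewrite linear0r normr0 mulr0.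
have nu : 0 < `|u| by rewrite normr_gt0.
have nv : 0 < `|v| by rewrite normr_gt0.
have := dot_ge0 (`|v| *: u - `|u| *: v).
rewrite !dotE -!sqr_normE (dotC v u) => H.
have : 0 <= (`|u| * `|v|) * (`|u| * `|v| - dot u v) by nra.
by rewrite pmulr_rge0 ?mulr_gt0// subr_ge0.
Qed.

End RealInnerProduct.

(** * Riesz representation and the gradient *)

Section Riesz.
Variables (R : realType) (E : finNormedModType R) (dot : {dot E for idfun}).

(* The Gram matrix of a basis is invertible since [dot] is definite. *)
Lemma riesz (phi : {linear E -> R}) : exists g : E, forall v, phi v = dot g v.
Proof.
pose b := vbasis {: E}%VS.
pose n := \dim {: E}%VS.
pose G : 'M[R]_n := \matrix_(i, j) dot b`_i b`_j.
pose comb (u : 'rV[R]_n) : E := \sum_i u 0 i *: b`_i.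
have dot_comb u (j : 'I_n) : dot (comb u) b`_j = (u *m G) 0 j.
  rewrite /comb dot_suml mxE; apply: eq_bigr => i _.
  by rewrite dotZl mxE.
have coordE v : v = \sum_i coord b i v *: b`_i by rewrite -coord_vbasis ?memvf.
have G_unit : G \in unitmx.
  rewrite -row_free_unit; apply/inj_row_free => u uG0.
  have comb0 : comb u = 0.
    apply: (@dot_eq0 _ _ dot); rewrite [X in dot _ X]/comb dot_sumr big1// => i _.
    by rewrite dotZr dot_comb uG0 mxE mulr0.
  apply/rowP => i; rewrite mxE.
  have /freeP := basis_free (vbasisP {: E}%VS).
  by apply.
pose p : 'rV[R]_n := \row_j phi b`_j.
(* These coefficients [c] solve [c *m G = p], so the combination pairs with each basis vector as
   [phi] does. *)
exists (comb (p *m invmx G)) => v.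
rewrite {1 2}(coordE v) linear_sum dot_sumr; apply: eq_bigr => i _.
by rewrite linearZ dotZr dot_comb mulmxKV// mxE.
Qed.

(** By [riesz] the set inside [gradient] is inhabited, which rules out the default value 0. *)
Lemma diff_gradient (f : E -> R) (y v : E) : differentiable f y ->
  'd f y v = dot (gradient dot f y) v.
Proof.
move=> fy; rewrite /gradient; case: xgetP => [g _ [_]//|none].
have [g gE] := riesz ('d f y).
by have := none g; case.
Qed.

End Riesz.

Lemma convex_function_line_le (R : realType) (E : normedModType R) (g : E -> R)
    (y z : E) (s : R) : convex_function [set: convex_lmodType E] g ->
  0 <= s -> s <= 1 -> g (s *: (z - y) + y) <= g y + s * (g z - g y).
Proof.
move=> g_convex s0 s1.
have H : g (s *: z + (1 - s) *: y) <= s * g z + (1 - s) * g y.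
  exact: (g_convex (Itv01 s0 s1) z y (in_setT _) (in_setT _)).
have -> : s *: (z - y) + y = s *: z + (1 - s) *: y.
  by rewrite scalerBr scalerBl scale1r -addrA [- _ + y]addrC.
by apply: (le_trans H); lra.
Qed.

(** * Linear lower bound and quadratic upper bound for a smooth convex function *)

Section SmoothConvex.
Variables (R : realType) (E : finNormedModType R) (dot : {dot E for idfun}).
Variable f : E -> R.
Hypothesis f_diff : forall y, differentiable f y.
Local Notation grad := (gradient dot f).

(** For [0 < s <= 1] convexity bounds the difference quotient of [f] at [y] in direction [z - y] by
    [f z - f y]; the bound survives the limit as [s] tends to 0 from the right. *)
Lemma convex_ge_gradient (y z : E) :
  convex_function [set: convex_lmodType E] f ->
  f y + dot (grad y) (z - y) <= f z.
Proof.
move=> f_convex; rewrite -diff_gradient// -deriveE// -lerBrDl.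
have fD : derivable f y (z - y) by exact: diff_derivable.
apply: (cvgr_to_le (cvg_dnbhs_at_right fD)); near=> s.
have s0 : 0 < s by [].
rewrite /= -[_ *: _]/(s^-1 * _) ler_pdivrMl//.
have := @convex_function_line_le _ _ f y z s f_convex (ltW s0).
by rewrite lerBlDl; apply; near: s; apply: nbhs_right_le.
Unshelve. all: by end_near. Qed.

Lemma is_derive_line (y d : E) (s : R) :
  is_derive s 1 (fun r : R => f (r *: d + y)) (dot (grad (s *: d + y)) d).
Proof.
rewrite -diff_gradient//.
have line : is_diff s (fun r : R => r *: d + y) (fun r => r *: d).
  apply: (is_diff_eq (is_diffD (is_diff_scalel s d) (is_diff_cst y s))).
  by apply/funext => r; rewrite fctE addr0.
have comp : is_diff s (f \o (fun r : R => r *: d + y))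
    ('d f (s *: d + y) \o (fun r : R => r *: d)).
  by apply: is_diff_comp.
split; first exact/diff_derivable.
by rewrite deriveE// diff_val /= scale1r.
Qed.

Hypothesis normE : norm_of_dot dot.

(* On the segment from [y] to [z] the difference of the two sides is
   decreasing, by Cauchy-Schwarz and the Lipschitz bound on the gradient. *)
Lemma descent (L : R) (y z : E) : L.-lipschitz grad ->
  f z <= f y + dot (grad y) (z - y) + L / 2 * `|z - y| ^+ 2.
Proof.
move=> grad_lip; set d := z - y.
pose phi (s : R) := f (s *: d + y) - s * dot (grad y) d - s ^+ 2 * (L / 2 * `|d| ^+ 2).
pose phi' (s : R) := dot (grad (s *: d + y)) d - dot (grad y) d - s * (L * `|d| ^+ 2).
have phiD (s : R) : is_derive s 1 phi (phi' s).
  have fD := is_derive_line y d s.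
  have linD := is_deriveM (is_derive_id s 1) (is_derive_cst (dot (grad y) d) s 1).
  have sqrD := is_deriveM (is_deriveX 2 (is_derive_id s 1))
    (is_derive_cst (L / 2 * `|d| ^+ 2) s 1).
  apply: (is_derive_eq (is_deriveB (is_deriveB fD linD) sqrD)).
  rewrite /phi' /GRing.scale/= !fctE/=; lra.
have phi'_le0 s : 0 <= s -> phi' s <= 0.
  move=> s0; rewrite /phi' -dotNl -dotDl.
  have := grad_lip (s *: d + y, y) (conj I I).
  rewrite /= addrK normrZ ger0_norm// => lip.
  have := dot_le_norm normE (grad (s *: d + y) - grad y) d.
  have := normr_ge0 d.
  by nra.
(* [phi 0] is [f y], and [phi 1] is [f z] minus the linear and quadratic terms, so this is the
   claim. *)
have : phi 1 <= phi 0.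
  apply: (@ler0_derive1_le_cc _ phi 0 1) => //.
  - move=> s; rewrite in_itv/= => /andP[/ltW s0 _].
    by rewrite derive1E derive_val phi'_le0.
  - by apply: derivable_within_continuous.
  - by rewrite in_itv/= lexx ler01.
  - by rewrite in_itv/= lexx ler01.
rewrite /phi scale1r scale0r add0r !mul1r expr1n expr0n/= !mul0r !subr0 subrK.
by lra.
Qed.

End SmoothConvex.

(** * Variational inequality for the proximal map *)

Section Prox.
Variables (R : realType) (E : normedModType R) (dot : {dot E for idfun}).
Hypothesis normE : norm_of_dot dot.

Lemma ge0_of_small_quadratic (a b : R) :
  (forall s, 0 < s -> s <= 1 -> 0 <= s * a + s ^+ 2 * b) -> 0 <= a.
Proof.
move=> H; rewrite leNgt; apply/negP => a0.
(* At [s = 1] the hypothesis reads [0 <= a + b], with [a < 0]. *)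
have b0 : 0 < b by have := H 1 ltr01 (lexx _); nra.
(* With this [s], [s * b <= - a / 2], hence [a + s * b <= a / 2 < 0], against the hypothesis divided
   by [s]. *)
pose s := Num.min 1 (- a / (2 * b)).
have q0 : 0 < - a / (2 * b) by rewrite divr_gt0 ?mulr_gt0 ?oppr_gt0.
have s0 : 0 < s by rewrite lt_min ltr01.
have s1 : s <= 1 by rewrite ge_min lexx.
have : s * (2 * b) <= - a by rewrite -ler_pdivlMr ?mulr_gt0// ge_min lexx orbT.
have := H s s0 s1.
rewrite expr2 -mulrA -mulrDr pmulr_rge0//; nra.
Qed.

(** Compare the minimizer [u] with [u + s (v - u)]. Convexity of [g] and expansion of the square
    leave [0 <= s a + s^2 b], where [a] is the gap in the claim and [b = |v - u|^2 / 2]. *)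
Lemma is_prox_le (g : E -> R) (y u v : E) :
  convex_function [set: convex_lmodType E] g -> is_prox g y u ->
  g u + dot (y - u) (v - u) <= g v.
Proof.
move=> g_convex u_prox; rewrite -subr_ge0.
apply: (@ge0_of_small_quadratic _ (2^-1 * `|v - u| ^+ 2)) => s s0 s1.
have := u_prox (s *: (v - u) + u).
have := convex_function_line_le u v g_convex (ltW s0) s1.
have -> : s *: (v - u) + u - y = s *: (v - u) - (y - u).
  by rewrite opprB addrA.
rewrite -(distrC y u) !(sqr_normE normE) !(dotE dot).
rewrite (dotC dot y v) (dotC dot u v) (dotC dot u y).
lra.
Qed.

Lemma convex_function_mull (t : R) (g : E -> R) : 0 <= t ->
  convex_function [set: convex_lmodType E] g ->
  convex_function [set: convex_lmodType E] (fun y => t * g y).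
Proof.
move=> t0 g_convex s y z yT zT.
have := ler_wpM2l t0 (g_convex s y z yT zT).
by rewrite !convRE; lra.
Qed.

End Prox.

(** * One proximal gradient step, then the rate *)

Section ProximalGradient.
Variables (R : realType) (E : finNormedModType R) (dot : {dot E for idfun}).
Hypothesis normE : norm_of_dot dot.
Variables (f h : E -> R) (L t : R).
Hypotheses (f_diff : forall y : E, differentiable f y)
  (f_convex : convex_function [set: convex_lmodType E] f)
  (L_gt0 : 0 < L) (grad_lip : L.-lipschitz (gradient dot f))
  (h_convex : convex_function [set: convex_lmodType E] h)
  (t_gt0 : 0 < t) (t_le : t <= 1 / L).
Let psi y := f y + h y.

(** In the sum of the three inequalities the gradient terms cancel, because
    [(v - u) + (u - y) = v - y]. Since [t L <= 1], the quadratic error is at most [|u - y|^2 / 2],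
    which the expansion of [dot (y - u) (v - u)] absorbs. *)
Lemma prox_grad_step (y u v : E) :
  is_prox (fun y => t * h y) (y - t *: gradient dot f y) u ->
  2 * t * (psi u - psi v) <= `|y - v| ^+ 2 - `|u - v| ^+ 2.
Proof.
move=> u_prox.
have := is_prox_le normE v (convex_function_mull (ltW t_gt0) h_convex) u_prox.
have /(ler_wpM2l (ltW t_gt0)) := convex_ge_gradient dot f_diff y v f_convex.
have /(ler_wpM2l (ltW t_gt0)) := descent f_diff normE y u grad_lip.
have tL : t * L <= 1 by rewrite -ler_pdivlMr.
have : t * L * `|u - y| ^+ 2 <= `|u - y| ^+ 2 by rewrite ler_piMl ?sqr_ge0.
rewrite /psi !(sqr_normE normE) !(dotE dot).
(* Symmetric products are given one orientation, so that [lra] sees equal atoms. *)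
rewrite (dotC dot v y) (dotC dot u y) (dotC dot v u).
lra.
Qed.

End ProximalGradient.

Theorem theorem9 (R : realType) (E : finNormedModType R)
    (dot : {dot E for idfun}) (normE : norm_of_dot dot)
    (f h : E -> R) (L t : R) (xstar : E) (x : nat -> E)
    (f_diff : forall y : E, differentiable f y)
    (f_convex : convex_function [set: convex_lmodType E] f)
    (L_gt0 : 0 < L)
    (grad_lip : L.-lipschitz (gradient dot f))
    (h_cont : continuous h)
    (h_convex : convex_function [set: convex_lmodType E] h)
    (psi := fun y : E => f y + h y)
    (xstar_min : forall y : E, psi xstar <= psi y)
    (t_gt0 : 0 < t) (t_le : t <= 1 / L)
    (x_step : forall k : nat,
       is_prox (fun y : E => t * h y)
         (x k - t *: gradient dot f (x k)) (x k.+1)) :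
  forall k : nat, (1 <= k)%N ->
    psi (x k) - psi xstar <= 1 / (2 * k%:R * t) * `|x 0%N - xstar| ^+ 2.
Proof.
have step k v := prox_grad_step normE f_diff f_convex L_gt0 grad_lip
  h_convex t_gt0 t_le v (x_step k).
have psi_decr k : psi (x k.+1) <= psi (x k).
  rewrite -subr_le0 -(pmulr_rle0 _ (mulr_gt0 (ltr0n R 2) t_gt0)).
  apply: (le_trans (step k (x k))).
  by rewrite subrr normr0 expr0n/= sub0r oppr_le0 sqr_ge0.
(* Without division the bound also makes sense at [k = 0], where both sides vanish. In the inductive
   step, monotonicity replaces [psi (x k)] by [psi (x k.+1)] in the term with factor [k]. *)
have sum k : 2 * k%:R * t * (psi (x k) - psi xstar) <=
    `|x 0%N - xstar| ^+ 2 - `|x k - xstar| ^+ 2.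
  elim: k => [|k IH]; first by rewrite mulr0 !mul0r subrr.
  have := step k xstar; have := psi_decr k.
  have /(ler_wpM2l (ler0n R k)) : t * psi (x k.+1) <= t * psi (x k) by rewrite ler_pM2l.
  rewrite -natr1 -/(psi _) -/(psi _).
  by lra.
move=> k k_gt0.
have kt_gt0 : 0 < 2 * k%:R * t by rewrite !mulr_gt0 ?ltr0n.
(* Here [1 <= k] makes the divisor positive; then the term [- |x k - xstar|^2] is dropped. *)
rewrite mul1r mulrC ler_pdivlMr// mulrC; apply: le_trans (sum k) _.
by rewrite gerBl sqr_ge0.
Qed.
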